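(* Let $W$ be the finite Coxeter group of type $A_4$ or $D_4$. For all $u\leqslant v$ in $W$ such that the number of reflections $r\in W$ with $u\leqslant vr<v$ equals $l(v)-l(u)$, the element $v$ admits a good word with respect to $u$.
   Context: $W$ is regarded as a Coxeter group with its set of simple reflections, length function $l$ and Bruhat order $\leqslant$; a reflection is a conjugate of a simple reflection. For $u\leqslant v$ in $W$, a good word for $v$ with respect to $u$ is a reduced decomposition $v=s_1\cdots s_n$ into simple reflections ($n=l(v)$) with the following property: if $j_1<\cdots<j_d$ are exactly the indices $j$ such that $u\leqslant s_1\cdots\widehat{s_j}\cdots s_n$ (the hat denotes an omitted factor), then $u=s_1\cdots\widehat{s_{j_1}}\cdots\widehat{s_{j_d}}\cdots s_n$. *)

(* Defs.v *)
From HB Require Import structures.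
From mathcomp Require Import all_boot all_fingroup.

Set Implicit Arguments.
Unset Strict Implicit.
Unset Printing Implicit Defensive.

Local Open Scope group_scope.

(* The entry 0 encodes an infinite bond: x ^+ 0 = 1 is no constraint. *)
Definition coxeter_relations (n : nat) (m : 'I_n -> 'I_n -> nat)
    (G : groupType) (f : 'I_n -> G) : Prop :=
  forall i j, (f i * f j) ^+ m i j = 1.

(* W is the group presented by generators s i and relations
   (s i * s j) ^+ m i j = 1. *)
Definition coxeter_system (n : nat) (m : 'I_n -> 'I_n -> nat)
    (W : finGroupType) (s : 'I_n -> W) : Prop :=
  [/\ coxeter_relations m s,
      <<[set s i | i : 'I_n]>> = [set: W]
    & forall (G : groupType) (f : 'I_n -> G), coxeter_relations m f ->
      exists phi : {multiplicative W -> G}, forall i, phi (s i) = f i].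

Definition simply_laced (n : nat) (e : rel 'I_n) (i j : 'I_n) : nat :=
  if i == j then 1%N else if e i j then 3%N else 2%N.

(* The path 0 - 1 - 2 - 3. *)
Definition coxeter_A4 : 'I_4 -> 'I_4 -> nat :=
  simply_laced (fun i j : 'I_4 => (i.+1 == j :> nat) || (j.+1 == i :> nat)).

(* The star with centre 1 and leaves 0, 2, 3. *)
Definition coxeter_D4 : 'I_4 -> 'I_4 -> nat :=
  simply_laced (fun i j : 'I_4 => (i == 1%N :> nat) (+) (j == 1%N :> nat)).

Section CoxeterNotions.

Variables (n : nat) (W : finGroupType) (s : 'I_n -> W).
Implicit Types (u v w : W) (t : seq 'I_n).

Definition word t : W := \prod_(i <- t) s i.

(* Restricting to words with fewer than #|W| letters loses nothing when the
   s i are involutions generating W: see word_coxeter_length and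
   coxeter_length_word. *)
Definition coxeter_length w : nat :=
  \big[minn/#|W|]_(k < #|W| | [exists t : k.-tuple 'I_n, word t == w]) k.

Definition reduced t : bool := size t == coxeter_length (word t).

Definition reflections : {set W} := \bigcup_(i < n) (s i ^: [set: W]).

Definition bruhat_step u v : bool :=
  [exists r in reflections,
    (v == u * r) && (coxeter_length u < coxeter_length v)].

Definition bruhat_le u v : bool := connect bruhat_step u v.

Definition bruhat_lt u v : bool := (u != v) && bruhat_le u v.

Definition omit (j : nat) t : seq 'I_n := take j t ++ drop j.+1 t.

(* The mask keeps exactly the positions j at which u is not below the word
   with its j-th letter omitted. *)
Definition good_word u v t : Prop :=
  [/\ word t = v, reduced t
    & u = word (mask [seq ~~ bruhat_le u (word (omit j t))
                     | j <- iota 0 (size t)] t)].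

Lemma coxeter_length_word t : coxeter_length (word t) <= size t.
Proof.
rewrite /coxeter_length; have [ltW|leW] := ltnP (size t) #|W|.
  have Pt : [exists t0 : (Ordinal ltW).-tuple 'I_n, word t0 == word t].
    by apply/existsP; exists (in_tuple t).
  elim: index_enum (mem_index_enum (Ordinal ltW)) => // k r IHr.
  rewrite inE big_cons => /predU1P[<-|/IHr ler]; first by rewrite Pt geq_minl.
  by case: ifP => // _; apply: leq_trans (geq_minr _ _) ler.
apply: leq_trans leW; elim/big_rec: _ => // k x _ lex.
exact: leq_trans (geq_minr _ _) lex.
Qed.

Lemma word_coxeter_length w :
    (forall i, s i * s i = 1) -> <<[set s i | i : 'I_n]>> = [set: W] ->
  exists2 t, word t = w & size t = coxeter_length w.
Proof.
move=> s2 genW.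
pose e : rel W := fun x y => [exists i, y == x * s i].
have conn1 : connect e 1 w.
  have: w \in <<[set s i | i : 'I_n]>> by rewrite genW inE.
  case/gen_prodgP=> k [c Hc ->].
  elim: k c Hc => [|k IHk] c Hc; first by rewrite big_ord0 connect0.
  rewrite big_ord_recr /=.
  have /imsetP[i _ ->] := Hc ord_max.
  apply: connect_trans (IHk (fun j => c (widen_ord (leqnSn k) j)) _) _ => //.
  by apply: connect1; apply/existsP; exists i.
case/connectP: conn1 => p0 ep0 wE; rewrite {}wE.
case/shortenP: ep0 => p ep up _.
have pword x q : path e x q -> exists2 t, x * word t = last x q & size t = size q.
  elim: q x => [|y q IHq] x /=; first by exists [::]; rewrite // /word big_nil mulg1.
  case/andP=> /existsP[i /eqP yE] /IHq[t tE st]; exists (i :: t); last by rewrite /= st.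
  by rewrite /word big_cons mulgA -yE.
have [t tE st] := pword _ _ ep; rewrite mul1g in tE.
have ltW : size t < #|W|.
  by rewrite st -[_.+1]/(size (1 :: p)) -(card_uniqP up) max_card.
rewrite -{}tE {p0 p ep up st pword}.
suff: coxeter_length (word t) = #|W| \/
      exists2 t', word t' = word t & size t' = coxeter_length (word t).
  case=> [lenE|//]; have := coxeter_length_word t; rewrite lenE leqNgt ltW //.
rewrite /coxeter_length; elim/big_rec: _ => [|k x Pk IHx]; first by left.
have [_|_] := leqP k x; last exact: IHx.
by right; case/existsP: Pk => t' /eqP tE; exists t'; rewrite ?size_tuple.
Qed.

End CoxeterNotions.

(* Main.v *)
From HB Require Import structures.
From Stdlib Require Import ZArith FMapPositive MSetPositive.
Require Import Defs.
From mathcomp Require Import all_boot all_fingroup.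

(** The groups have 120 and 192 elements and 3387 and 7983 pairs (u, v) satisfy
the hypothesis, so the statement is decided by a finite search.  The work is to
make that search about an arbitrary W that is only known by its Coxeter
presentation, and to make it small.

A Cayley table (act k i, for a state k and a letter i) together with one reduced
word per state is computed by playing Mozes's numbers game on the Coxeter graph.
Nothing is proved about the game: a boolean test of the resulting table
(cayley_table) implies that its states are a copy of W.
- There are enough relations: elt k, the element spelled by the normal form of
  k, satisfies elt (act k i) = elt k * s i (elt_act).  By induction on length
  this reduces to two descents i, j of one state, where it is the braid relation
  between s i and s j (elt_descent).
- There are enough elements: the letters act on the states by permutations that
  satisfy the Coxeter relations, so the universal property of the presentation
  turns W into a group of permutations, and a word determines the state that it
  reaches from 1 (run_word).
Hence elt and code are inverse bijections between states and W, which turn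
length into the length of normal forms (coxeter_length_code) and reflections
into an explicit list (mem_reflections).

The Bruhat order is stored as the set of states below each state.  These sets
need not be traced back to their construction: the recursion
  down v = {v} union the down (v r) for the reflections r with l(v r) < l(v)
determines them by induction on length, and is tested (mem_down).

The search then takes, for each v, all the u below v that satisfy the counting
hypothesis (tight), and runs through the reduced words of v, each time removing
the u for which the word is good, until no u remains (covered). *)

Set Implicit Arguments.
Unset Strict Implicit.
Unset Printing Implicit Defensive.

Local Open Scope group_scope.

(** * Words and letters *)

HB.instance Definition _ := hasDecEq.Build positive
  (fun x y => equivP idP (Pos.eqb_eq x y)).
HB.instance Definition _ := CanIsCountable Pos2Nat.id.

(** An explicit list, because the enumeration of 'I_4 is opaque to
computation. *)
Definition letters : seq 'I_4 :=
  [:: @Ordinal 4 0 isT; @Ordinal 4 1 isT; @Ordinal 4 2 isT; @Ordinal 4 3 isT].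

Lemma mem_letters i : i \in letters.
Proof.
case: i => [[|[|[|[|//]]]] i4]; rewrite !inE -!val_eqE /= ?eqxx ?orbT //.
Qed.

Lemma all_lettersP (p : pred 'I_4) : reflect (forall i, p i) (all p letters).
Proof.
by apply: (iffP allP) => pl i => [|_]; [apply: pl (mem_letters i) | apply: pl].
Qed.

Lemma word_cat n (W : finGroupType) (s : 'I_n -> W) t1 t2 :
  word s (t1 ++ t2) = word s t1 * word s t2.
Proof. exact: big_cat. Qed.

Lemma word_seq1 n (W : finGroupType) (s : 'I_n -> W) i : word s [:: i] = s i.
Proof. exact: big_seq1. Qed.

Lemma word_rcons n (W : finGroupType) (s : 'I_n -> W) t i :
  word s (rcons t i) = word s t * s i.
Proof. by rewrite -cats1 word_cat word_seq1. Qed.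

(** * Tables and the tests to run on them *)

Section Automaton.

(** A state k stands for an element w of W: the table gives the states of the
w * s i, then a reduced word of w.  The identity is state 1.  States are binary
numbers so that a lookup costs about eight steps. *)

Variable tbl : PositiveMap.t (seq positive * seq 'I_4).

Definition entry (k : positive) := odflt ([::], [::]) (PositiveMap.find k tbl).
Definition act (k : positive) (i : 'I_4) : positive := nth 1%positive (entry k).1 i.
Definition normal_form k : seq 'I_4 := (entry k).2.
Definition len k := size (normal_form k).
Definition run : positive -> seq 'I_4 -> positive := foldl act.
Definition states : seq positive := [seq x.1 | x <- PositiveMap.elements tbl].

Fixpoint descending k t :=
  if t is i :: t' then (len (act k i) < len k) && descending (act k i) t'
  else true.

(** The alternating word of length n, for n at most 3: no bond of a simply laced
graph needs a longer one. *)
Definition alternating n (i j : 'I_4) := take n [:: i; j; i].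

Definition closed_table :=
  (1%positive \in states) && (normal_form 1 == [::])
  && all (fun k => all (fun i => act k i \in states) letters) states.

(** The second test makes the normal forms a spanning tree of the Cayley graph,
rooted at state 1. *)
Definition normal_form_ok k :=
  (run 1 (normal_form k) == k) &&
  (if normal_form k is a :: t then
     let i := last a t in normal_form k == rcons (normal_form (act k i)) i
   else true).

Definition relations_ok (m : 'I_4 -> 'I_4 -> nat) k :=
  all (fun i => all (fun j =>
    run k (flatten (nseq (m i j) [:: i; j])) == k) letters) letters.

Definition adjacent_len_ok k :=
  all (fun i => (len (act k i) == (len k).+1) || (len k == (len (act k i)).+1))
    letters.

(** Both alternating words in two descents of k lead down to the minimal state
of the dihedral coset of k. *)
Definition braid_ok (m : 'I_4 -> 'I_4 -> nat) k :=
  let ds := [seq i <- letters | len (act k i) < len k] in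
  all (fun i => all (fun j =>
    [&& descending k (alternating (m i j) i j),
        descending k (alternating (m i j) j i)
      & run k (alternating (m i j) i j) == run k (alternating (m i j) j i)])
    ds) ds.

Definition cayley_table m :=
  closed_table && all (fun k =>
    [&& normal_form_ok k, relations_ok m k, adjacent_len_ok k & braid_ok m k])
    states.

(** The word is s i conjugated by the element of k. *)
Definition reflection_codes : seq positive :=
  undup [seq run 1 (rev (normal_form k) ++ i :: normal_form k) |
          k <- states, i <- letters].

Variables (refl : seq positive) (downs : PositiveMap.t PositiveSet.t).

Definition down k := odflt PositiveSet.empty (PositiveMap.find k downs).

Definition neighbours k : seq positive := [seq run k (normal_form r) | r <- refl].

Definition union_down base xs :=
  foldl PositiveSet.union base [seq down x | x <- xs].

Definition down_ok k :=
  PositiveSet.equal (down k)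
    (union_down (PositiveSet.singleton k)
       [seq x <- neighbours k | len x < len k]).

(** Recursion on the length n of k: last letters are the descents of k. *)
Fixpoint reduced_words n k : seq (seq 'I_4) :=
  if n is n'.+1 then
    flatten [seq [seq rcons t i | t <- reduced_words n' (act k i)] |
              i <- letters & len (act k i) < n]
  else [:: [::]].

(** The tables of omitted words are computed before h is given, so that one word
can be tried on many h. *)
Definition good_code t :=
  let omits := [seq down (run 1 (omit j t)) | j <- iota 0 (size t)] in
  fun h => run 1 (mask [seq ~~ PositiveSet.mem h d | d <- omits] t) == h.

(** One word is tried on the whole list before the next: most states leave the
list at the first few words, and the work on t is shared among them. *)
Fixpoint covered k (hs : seq positive) (ts : seq (seq 'I_4)) :=
  if hs is [::] then true else
  if ts is t :: ts' then
    (run 1 t == k) && (size t == len k) &&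
    (let good := good_code t in covered k [seq h <- hs | ~~ good h] ts')
  else false.

(** The pairs (h, k) that satisfy the counting hypothesis; h = k is one of them,
with no reflection to count. *)
Definition tight k : seq positive :=
  let ds := [seq down x | x <- neighbours k &
                          (x != k) && PositiveSet.mem x (down k)] in
  [seq h <- states | PositiveSet.mem h (down k) &&
     (count (PositiveSet.mem h) ds == len k - len h)].

Definition bruhat_table :=
  (refl == reflection_codes) && all down_ok states.

Definition all_good :=
  all (fun k => covered k (tight k) (reduced_words (len k) k)) states.

End Automaton.

(** * A valid table describes the Coxeter group *)

Section Coding.

Variables (e : rel 'I_4) (W : finGroupType) (s : 'I_4 -> W).
Variable tbl : PositiveMap.t (seq positive * seq 'I_4).
Let m := simply_laced e.
Hypothesis sysW : coxeter_system m s.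
Hypothesis tblP : cayley_table tbl m.

Local Notation act := (act tbl).
Local Notation normal_form := (normal_form tbl).
Local Notation len := (len tbl).
Local Notation run := (run tbl).
Local Notation states := (states tbl).

Definition elt k := word s (normal_form k).

Lemma state1 : 1%positive \in states.
Proof. by case/andP: tblP => /andP[/andP[]]. Qed.

Lemma state_act k i : k \in states -> act k i \in states.
Proof. by case/andP: tblP => /andP[_ /allP cl _] /cl/all_lettersP. Qed.

Lemma state_run k t : k \in states -> run k t \in states.
Proof. by elim: t k => //= i t IHt k /(state_act i)/IHt. Qed.

Lemma state_ok k : k \in states ->
  [/\ normal_form_ok tbl k, relations_ok tbl m k, adjacent_len_ok tbl k
    & braid_ok tbl m k].
Proof. by case/andP: tblP => _ /allP ok /ok/and4P. Qed.

Lemma run_cat k t1 t2 : run k (t1 ++ t2) = run (run k t1) t2.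
Proof. exact: foldl_cat. Qed.

Lemma run_normal_form k : k \in states -> run 1 (normal_form k) = k.
Proof. by case/state_ok => /andP[/eqP]. Qed.

Lemma run_relation k i j : k \in states ->
  run k (flatten (nseq (m i j) [:: i; j])) = k.
Proof. by case/state_ok => _ /all_lettersP/(_ i)/all_lettersP/(_ j)/eqP. Qed.

Lemma actK k i : k \in states -> act (act k i) i = k.
Proof. by move/(run_relation i i); rewrite /m /simply_laced eqxx. Qed.

Lemma len_act k i : k \in states ->
  len (act k i) = (len k).+1 \/ len k = (len (act k i)).+1.
Proof. by case/state_ok=> _ _ /all_lettersP/(_ i)/orP[]/eqP; [left|right]. Qed.

Lemma gen_invol i : s i * s i = 1.
Proof. by case: sysW => /(_ i i); rewrite /m /simply_laced eqxx expg1. Qed.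

Lemma genV i : (s i)^-1 = s i.
Proof. by apply/eqP; rewrite eq_invg_mul gen_invol. Qed.

(** For involutions, (s i * s j) ^+ m = 1 says that the two alternating products
with m factors agree. *)
Lemma alternating_relation i j :
  word s (rev (alternating (m i j) i j)) = word s (rev (alternating (m i j) j i)).
Proof.
case: sysW => /(_ i j) + _ _; rewrite /m /simply_laced /alternating.
case: eqVneq => [-> //| _].
rewrite /word; case: (e i j) => /=; rewrite !big_cons !big_nil !mulg1.
  rewrite !expgS expg0 mulg1 => rel; apply/eqP.
  by rewrite eq_mulgV1 !invMg !genV; apply/eqP; rewrite -rel !mulgA.
rewrite !expgS expg0 mulg1 => rel; apply/esym/eqP.
by rewrite eq_mulgV1 !invMg !genV; apply/eqP; rewrite -rel !mulgA.
Qed.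

(** Let j be the last letter of the normal form of k, for which the equation
holds by construction, and let i be another descent.  The two alternating words
in i and j of length m j i both descend from k to the same state x.  By
induction the equation holds along all their edges below k, so elt k and
elt (act k i) * s i are elt x times the two sides of the braid relation. *)
Lemma elt_descent k i : k \in states -> len (act k i) < len k ->
  elt k = elt (act k i) * s i.
Proof.
have [n] := ubnP (len k); elim: n => // n IHn in k i *.
rewrite ltnS => lekn Sk ltk.
have chain t : forall x, x \in states -> len x < n -> descending tbl x t ->
    elt x = elt (run x t) * word s (rev t).
  elim: t => [|j t IHt] x Sx ltxn /=; first by rewrite /word big_nil mulg1.
  case/andP=> ltj dt; rewrite (IHn x j) // (IHt _ (state_act j Sx)) //.
    by rewrite rev_cons word_rcons mulgA.
  exact: ltn_trans ltxn.
case: (state_ok Sk) => /andP[_ nfk] _ _ /allP brk.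
case nfE: (normal_form k) nfk => [|a t]; first by rewrite /len nfE in ltk.
set j := last a t => /eqP nfj; rewrite -nfE in nfj.
have tree : elt k = elt (act k j) * s j by rewrite /elt nfj word_rcons.
have ltj : len (act k j) < len k by rewrite /len nfj size_rcons.
have jd : j \in [seq a <- letters | len (act k a) < len k].
  by rewrite mem_filter ltj mem_letters.
have id : i \in [seq a <- letters | len (act k a) < len k].
  by rewrite mem_filter ltk mem_letters.
have /allP/(_ i id)/and3P[] := brk j jd.
have m_gt0 : 0 < m j i by rewrite /m /simply_laced; do 2?case: ifP.
have rel := alternating_relation j i.
case: (m j i) m_gt0 rel => // p _; rewrite /alternating /= !rev_cons !word_rcons.
move=> rel /andP[_ dj] /andP[_ di] /eqP runE.
rewrite tree (chain _ _ (state_act j Sk) _ dj) ?(leq_trans ltj) //.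
rewrite (chain _ _ (state_act i Sk) _ di) ?(leq_trans ltk) //.
by rewrite -!mulgA rel runE.
Qed.

Lemma elt_act k i : k \in states -> elt (act k i) = elt k * s i.
Proof.
move=> Sk; have Ski := state_act i Sk.
have [lenE|lenE] := len_act i Sk.
  by rewrite (elt_descent (i := i) Ski) ?actK // lenE.
by rewrite (elt_descent (i := i) Sk) ?lenE // -mulgA gen_invol mulg1.
Qed.

Lemma elt_run k t : k \in states -> elt (run k t) = elt k * word s t.
Proof.
elim: t k => [|i t IHt] k Sk /=; first by rewrite /word big_nil mulg1.
by rewrite IHt ?state_act // elt_act // -mulgA /word big_cons.
Qed.

Lemma normal_form1 : normal_form 1 = [::].
Proof. by case/andP: tblP => /andP[/andP[_ /eqP]]. Qed.

Lemma word_run t : word s t = elt (run 1 t).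
Proof. by rewrite elt_run ?state1 // /elt normal_form1 /word big_nil mul1g. Qed.

Definition act_state i (x : seq_sub states) : seq_sub states :=
  SeqSub (state_act i (valP x)).

Lemma act_stateK i : cancel (act_state i) (act_state i).
Proof. by move=> x; apply: val_inj; rewrite /= actK ?(valP x). Qed.

Definition act_perm i : {perm seq_sub states} := perm (can_inj (act_stateK i)).

Lemma val_prod_act_perm t x : val ((\prod_(i <- t) act_perm i) x) = run (val x) t.
Proof.
elim: t x => [|i t IHt] x; first by rewrite big_nil perm1.
by rewrite big_cons permM IHt permE.
Qed.

Lemma act_perm_relations : coxeter_relations m act_perm.
Proof.
move=> i j; apply/permP=> x; apply: val_inj; rewrite perm1.
rewrite -[RHS](run_relation i j (valP x)) -val_prod_act_perm.
congr (val (fun_of_perm _ x)); elim: (m i j) => [|p IHp] /=.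
  by rewrite expg0 big_nil.
by rewrite expgS IHp !big_cons mulgA.
Qed.

(** This is where the universal property enters: it gives a morphism from W to
the permutations of the states that maps word s t to the action of t. *)
Lemma run_word t1 t2 : word s t1 = word s t2 -> run 1 t1 = run 1 t2.
Proof.
case: sysW => _ _ /(_ _ _ act_perm_relations)[phi phiE] eqt.
have phi_word t : phi (word s t) = \prod_(i <- t) act_perm i.
  elim: t => [|i t IHt]; last by rewrite /word !big_cons gmulfM phiE IHt.
  by rewrite /word !big_nil; apply: (mulgI (phi 1)); rewrite -gmulfM !mulg1.
pose x1 : seq_sub states := SeqSub state1.
by rewrite -[LHS](val_prod_act_perm t1 x1) -phi_word eqt phi_word val_prod_act_perm.
Qed.

(** By codeP the find succeeds, so the default value 1 is never used. *)
Definition code w : positive :=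
  nth 1%positive states (find (fun k => elt k == w) states).

Lemma word_surj w : exists2 t, word s t = w & size t = coxeter_length s w.
Proof. by case: sysW => _ gen _; apply: word_coxeter_length gen_invol gen. Qed.

Lemma codeP w : code w \in states /\ elt (code w) = w.
Proof.
have [t <- _] := word_surj w.
have hk : has (fun k => elt k == word s t) states.
  by apply/hasP; exists (run 1 t); rewrite ?state_run ?state1 // -word_run.
by split; [rewrite mem_nth -?has_find | apply/eqP/(nth_find _ hk)].
Qed.

Lemma state_code w : code w \in states. Proof. by case: (codeP w). Qed.

Lemma codeK : cancel code elt. Proof. by move=> w; case: (codeP w). Qed.

Lemma code_word t : code (word s t) = run 1 t.
Proof.
rewrite -[LHS]run_normal_form ?state_code //; apply: run_word.
exact: codeK.
Qed.

Lemma eltK k : k \in states -> code (elt k) = k.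
Proof. by move=> Sk; rewrite code_word run_normal_form. Qed.

Lemma code_mul w t : code (w * word s t) = run (code w) t.
Proof. by rewrite -{1}(codeK w) -elt_run ?eltK ?state_run ?state_code. Qed.

(** A letter changes the length of a state by at most one, so no word for w is
shorter than its normal form. *)
Lemma coxeter_length_code w : coxeter_length s w = len (code w).
Proof.
apply/eqP; rewrite eqn_leq -{1}(codeK w) coxeter_length_word /=.
have [t <- <-] := word_surj w; rewrite code_word.
elim/last_ind: t => [|t i IHt]; first by rewrite /= /len normal_form1.
rewrite size_rcons -cats1 run_cat /=.
have [->|lenE] := len_act i (state_run t state1); first by rewrite ltnS.
by rewrite (leq_trans _ (leqW IHt)) // lenE leqW.
Qed.

Lemma rev_word t : word s (rev t) = (word s t)^-1.
Proof.
elim: t => [|i t IHt]; first by rewrite /word big_nil invg1.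
by rewrite rev_cons word_rcons IHt /word big_cons invMg genV.
Qed.

Lemma mem_reflections w : (w \in reflections s) = (code w \in reflection_codes tbl).
Proof.
have conjE i k : s i ^ elt k = word s (rev (normal_form k) ++ i :: normal_form k).
  by rewrite word_cat rev_word /word big_cons.
rewrite mem_undup; apply/bigcupP/allpairsP.
  case=> i _ /imsetP[x _ ->]; exists (code x, i); split=> /=.
  - exact: state_code.
  - exact: mem_letters.
  by rewrite -code_word -conjE codeK.
case=> -[k i] /= [Sk _ codeE]; exists i => //.
by rewrite -(codeK w) codeE -word_run -conjE imset_f ?inE.
Qed.

Lemma reflection_invol w : w \in reflections s -> w * w = 1.
Proof.
by case/bigcupP=> i _ /imsetP[x _ ->]; rewrite -conjMg gen_invol conj1g.
Qed.

(** * The Bruhat order and good words in terms of states *)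

Variables (refl : seq positive) (downs : PositiveMap.t PositiveSet.t).
Hypothesis downsP : bruhat_table tbl refl downs.

Local Notation down := (down downs).
Local Notation neighbours := (neighbours tbl refl).

Lemma reflE : refl = reflection_codes tbl.
Proof. by case/andP: downsP => /eqP. Qed.

Lemma neighbourP v h :
  reflect (exists2 r, r \in reflections s & h = code (v * r))
          (h \in neighbours (code v)).
Proof.
apply: (iffP mapP) => -[r rP ->].
  have Sr : r \in states.
    move: rP; rewrite reflE mem_undup => /allpairsP[[k i] /= [Sk _ ->]].
    exact: state_run state1.
  by exists (elt r); rewrite ?mem_reflections ?eltK -?reflE // code_mul.
exists (code r); first by rewrite reflE -mem_reflections.
by rewrite -code_mul -/(elt _) codeK.
Qed.

Lemma connect_last (T : finType) (r : rel T) x y :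
  connect r x y = (x == y) || [exists z, connect r x z && r z y].
Proof.
apply/idP/orP => [/connectP[p] | [/eqP-> // | /existsP[z /andP[xz zy]]]].
- elim/last_ind: p => [_ -> | p z _ /[swap] ->]; first by left.
  rewrite last_rcons rcons_path => /andP[pP rz]; right; apply/existsP.
  by exists (last x p); rewrite rz andbT; apply/connectP; exists p.
- exact: connect_trans xz (connect1 zy).
Qed.

Lemma mem_union_down h base xs :
  PositiveSet.mem h (union_down downs base xs) =
  PositiveSet.mem h base || has (fun x => PositiveSet.mem h (down x)) xs.
Proof.
rewrite /union_down; elim: xs base => [|x xs IHxs] base /=.
  by rewrite orbF.
rewrite IHxs orbA; congr (_ || _).
by apply/idP/orP => /PositiveSet.union_spec.
Qed.

(** Induction on the length of v: the last step of a Bruhat chain from u to v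
starts at some v * r, because r is its own inverse, and v * r is shorter. *)
Lemma mem_down u v : PositiveSet.mem (code u) (down (code v)) = bruhat_le s u v.
Proof.
have [n] := ubnP (len (code v)); elim: n => // n IHn in v *; rewrite ltnS => len_v.
have -> : PositiveSet.mem (code u) (down (code v)) =
    PositiveSet.mem (code u)
      (union_down downs (PositiveSet.singleton (code v))
         [seq x <- neighbours (code v) | len x < len (code v)]).
  case/andP: downsP => _ /allP/(_ _ (state_code v))/PositiveSet.equal_spec eqd.
  by apply/idP/idP => /eqd.
rewrite mem_union_down /bruhat_le connect_last; congr (_ || _).
  apply/idP/eqP => [/PositiveSet.singleton_spec/(can_inj codeK) //|->].
  exact/PositiveSet.singleton_spec.
apply/hasP/existsP => [[x] | [z /andP[uz /existsP[r /and3P[rR /eqP vE ltl]]]]].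
  rewrite mem_filter => /andP[ltx /neighbourP[r rR xE]] ux; exists (v * r).
  rewrite -/(bruhat_le s u _) -IHn -xE ?(leq_trans ltx) // ux.
  apply/existsP; exists r; rewrite rR !coxeter_length_code -xE ltx andbT.
  by rewrite -mulgA reflection_invol // mulg1 eqxx.
rewrite !coxeter_length_code in ltl; exists (code z).
  rewrite mem_filter ltl; apply/neighbourP; exists r => //.
  by rewrite vE -mulgA reflection_invol // mulg1.
by rewrite IHn // (leq_trans ltl).
Qed.

Lemma card_reflections (p : pred W) :
  #|[set r in reflections s | p r]| = count (fun k => p (elt k)) refl.
Proof.
have Srefl k : k \in refl -> k \in states.
  rewrite reflE mem_undup => /allpairsP[[h i] /= [Sh _ ->]].
  exact: state_run state1.
rewrite -size_filter -(size_map elt) -(card_uniqP _); last first.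
  rewrite map_inj_in_uniq ?filter_uniq ?reflE ?undup_uniq // -reflE => k h.
  rewrite !mem_filter => /andP[_ /Srefl Sk] /andP[_ /Srefl Sh] eqkh.
  by rewrite -(eltK Sk) eqkh eltK.
apply: eq_card => w; rewrite !inE mem_reflections -reflE.
apply/andP/mapP => [[Rw pw] | [k]].
  by exists (code w); rewrite ?mem_filter ?codeK ?pw.
by rewrite mem_filter => /andP[pk Rk] ->; rewrite eltK ?Srefl.
Qed.

Lemma mem_tight u v : bruhat_le s u v ->
  #|[set r in reflections s |
      bruhat_le s u (v * r) && bruhat_lt s (v * r) v]|
    = coxeter_length s v - coxeter_length s u ->
  code u \in tight tbl refl downs (code v).
Proof.
move=> le_uv card; rewrite mem_filter state_code mem_down le_uv andbT /=.
rewrite -!coxeter_length_code -card card_reflections count_map count_filter.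
rewrite count_map; apply/eqP/eq_count => r /=.
rewrite -code_mul -/(elt r) !mem_down /bruhat_lt; congr (_ && (_ && _)).
by rewrite (can_eq codeK).
Qed.

Lemma good_codeP u v t : run 1 t = code v -> size t = len (code v) ->
  good_code tbl downs t (code u) -> good_word s u v t.
Proof.
move=> runE sizeE /eqP good; have wordE : word s t = v.
  by rewrite word_run runE codeK.
split=> //; first by rewrite /reduced wordE coxeter_length_code sizeE.
rewrite -[LHS]codeK -good -word_run -map_comp; congr (word s (mask _ t)).
by apply: eq_map => j /=; rewrite -code_word mem_down.
Qed.

(** A state leaves the list hs only when some word is good for it, and the
search fails if the words run out before the list is empty. *)
Lemma coveredP u v hs ts : code u \in hs -> covered tbl downs (code v) hs ts ->
  exists t, good_word s u v t.
Proof.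
elim: ts hs => [|t ts IHts] [|h hs] //; set us := h :: hs => u_hs.
case/andP=> /andP[/eqP runE /eqP sizeE] cov.
have [good|bad] := boolP (good_code tbl downs t (code u)).
  by exists t; apply: good_codeP good.
by apply: IHts cov; rewrite mem_filter bad.
Qed.

Lemma good_word_exists u v : all_good tbl refl downs -> bruhat_le s u v ->
  #|[set r in reflections s |
      bruhat_le s u (v * r) && bruhat_lt s (v * r) v]|
    = coxeter_length s v - coxeter_length s u ->
  exists t, good_word s u v t.
Proof.
move=> /allP/(_ _ (state_code v)) cov le_uv /(mem_tight le_uv) u_tight.
exact: coveredP u_tight cov.
Qed.

End Coding.

(** * Tables for A4 and D4 *)

(** One move of the numbers game.  The position attached to w has as coordinates
the pairings of w^-1 rho with the simple coroots, so that firing i, which applies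
the reflection s i to w^-1 rho, leads to the position of w * s i. *)
Definition fire (m : 'I_4 -> 'I_4 -> nat) (i : 'I_4) (c : seq Z) : seq Z :=
  let ci := nth 0%Z c i in
  [seq if m i j == 1%N then (- ci)%Z
       else if m i j == 3%N then (nth 0%Z c j + ci)%Z else nth 0%Z c j |
    j <- letters].

(** The outer fold runs over the old list only, so that one call adds one layer
of the Cayley graph and every recorded word is shortest. *)
Definition grow m (orb : seq (seq Z * seq 'I_4)) :=
  foldl (fun acc x => foldl (fun acc i =>
      let c := fire m i x.1 in
      if has (fun y => all2 Z.eqb c y.1) acc then acc else rcons acc (c, rcons x.2 i))
    acc letters) orb orb.

(** The longest elements have length 10 in A4 and 12 in D4.  The game starts at
rho, all of whose coordinates are 1. *)
Definition orbit m := iter 12 (grow m) [:: (nseq 4 1%Z, [::])].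

Definition make_table m : PositiveMap.t (seq positive * seq 'I_4) :=
  let orb := orbit m in
  let number c := Pos.of_succ_nat (find (fun y => all2 Z.eqb c y.1) orb) in
  foldl (fun d x => PositiveMap.add (number x.1)
                      ([seq number (fire m i x.1) | i <- letters], x.2) d)
    (PositiveMap.empty _) orb.

(** States are treated in order of length, so that the sets needed for k are
already stored. *)
Definition make_downs tbl refl : PositiveMap.t PositiveSet.t :=
  foldl (fun d k => PositiveMap.add k
      (union_down d (PositiveSet.singleton k)
        [seq x <- neighbours tbl refl k | len tbl x < len tbl k]) d)
    (PositiveMap.empty _)
    (sort (fun k h => len tbl k <= len tbl h) (states tbl)).

(** The tables are stored in normal form, so that the tests that follow do not
rebuild them at every lookup. *)
Definition table_A4 := Eval vm_compute in make_table coxeter_A4.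
Definition refl_A4 := Eval vm_compute in reflection_codes table_A4.
Definition downs_A4 := Eval vm_compute in make_downs table_A4 refl_A4.

Definition table_D4 := Eval vm_compute in make_table coxeter_D4.
Definition refl_D4 := Eval vm_compute in reflection_codes table_D4.
Definition downs_D4 := Eval vm_compute in make_downs table_D4 refl_D4.

Lemma cayley_A4 : cayley_table table_A4 coxeter_A4.
Proof. by vm_compute. Qed.

Lemma bruhat_A4 : bruhat_table table_A4 refl_A4 downs_A4.
Proof. by vm_compute. Qed.

Lemma good_A4 : all_good table_A4 refl_A4 downs_A4.
Proof. by vm_compute. Qed.

Lemma cayley_D4 : cayley_table table_D4 coxeter_D4.
Proof. by vm_compute. Qed.

Lemma bruhat_D4 : bruhat_table table_D4 refl_D4 downs_D4.
Proof. by vm_compute. Qed.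

Lemma good_D4 : all_good table_D4 refl_D4 downs_D4.
Proof. by vm_compute. Qed.

Theorem proposition2 (W : finGroupType) (s : 'I_4 -> W)
  (hW : coxeter_system coxeter_A4 s \/ coxeter_system coxeter_D4 s)
  (u v : W) (huv : bruhat_le s u v)
  (hcard : #|[set r in reflections s |
               bruhat_le s u (v * r)%g && bruhat_lt s (v * r)%g v]|
           = coxeter_length s v - coxeter_length s u) :
  exists t : seq 'I_4, good_word s u v t.
Proof.
case: hW => sysW.
  exact: good_word_exists sysW cayley_A4 _ _ bruhat_A4 _ _ good_A4 huv hcard.
exact: good_word_exists sysW cayley_D4 _ _ bruhat_D4 _ _ good_D4 huv hcard.
Qed.
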